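(* Let $X$, $Y$, $Z$ be positive, absolutely continuous random variables with densities $f_X$, $f_Y$, $f_Z$, such that $X$ and $Y$ are independent and $Z \stackrel{d}{=} X/(X+Y)$ (so $Z$ takes values in $(0,1)$). Suppose that the density of $Y$ admits the decomposition $$f_Y(sx)=\mathbb{A}(s)\,\mathbb{B}(x)\,\mathbb{C}(sx),\qquad x,s>0,$$ for some positive real-valued functions $\mathbb{A},\mathbb{B},\mathbb{C}$ on $(0,\infty)$, where $$\mathbb{C}(x)=\exp(-\lambda x^\theta),\qquad x>0,$$ for some constants $\lambda,\theta>0$. Then the density of $X$ is given, for $x>0$, by $$f_X(x)=\frac{\lambda\theta}{x^{2-\theta}\,\mathbb{B}(x)}\;\mathcal{L}^{-1}\left\{\frac{1}{\mathbb{A}(s^{1/\theta})\,(s^{1/\theta}+1)^2}\, f_Z\!\left(\frac{1}{s^{1/\theta}+1}\right)\right\}(\lambda x^\theta).$$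
   Context: $\mathcal{L}$ denotes the Laplace transform, $\mathcal{L}\{g\}(s)=\int_0^\infty e^{-st}g(t)\,\mathrm{d}t$, and $\mathcal{L}^{-1}$ denotes the inverse Laplace transform: $\mathcal{L}^{-1}\{F\}$ is the function $g$ on $(0,\infty)$ with $\mathcal{L}\{g\}=F$; the expression $\mathcal{L}^{-1}\{F\}(t)$ means this function evaluated at $t$. The notation $\stackrel{d}{=}$ means equality in distribution. *)

(* Defs.v *)
From HB Require Import structures.
From mathcomp Require Import all_boot all_order all_algebra.
From mathcomp Require Import all_classical all_reals all_analysis.
Set Implicit Arguments. Unset Strict Implicit. Unset Printing Implicit Defensive.
Import Order.TTheory GRing.Theory Num.Theory.
Import numFieldNormedType.Exports.
Local Open Scope classical_set_scope.
Local Open Scope ring_scope.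

Section Defs.
Context (d : measure_display) (T : measurableType d) (R : realType)
        (P : probability T R).

Definition is_density (X : T -> R) (f : R -> R) : Prop :=
  (forall x, 0 <= f x) /\ measurable_fun setT f /\
  forall A : set R, measurable A ->
    P (X @^-1` A) = (\int[@lebesgue_measure R]_(x in A) (f x)%:E)%E.

Definition indep2 (X Y : T -> R) : Prop :=
  forall A B : set R, measurable A -> measurable B ->
    P (X @^-1` A `&` Y @^-1` B) = (P (X @^-1` A) * P (Y @^-1` B))%E.

Definition eq_in_dist (X Y : T -> R) : Prop :=
  forall A : set R, measurable A -> P (X @^-1` A) = P (Y @^-1` A).

Definition as_positive (X : T -> R) : Prop := P [set w | X w <= 0] = 0%E.
End Defs.

Definition laplace (R : realType) (g : R -> R) (s : R) : \bar R :=
  (\int[@lebesgue_measure R]_(t in `]0%R, +oo[) (expR (- (s * t)) * g t)%:E)%E.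

Definition is_inv_laplace (R : realType) (F g : R -> R) : Prop :=
  {ae @lebesgue_measure R, forall s, 0 < s ->
     (@lebesgue_measure R).-integrable `]0%R, +oo[
        (fun t => (expR (- (s * t)) * g t)%:E) /\
     laplace g s = (F s)%:E}.

(* Main.v *)
(* Put S = (Y / X)^theta, so that Z = 1 / (S^(1/theta) + 1). The density of S is
   computed twice. From f_Z by change of variables, it is
   f_Z (1 / (u + 1)) u' / (u + 1)^2 at s, where u = s^(1/theta). From the
   independence of X and Y and Tonelli's theorem, it is the integral over x of
   f_X x * f_Y (u x) * x u'. Both agree almost everywhere. In the second one,
   f_Y (u x) = A u * B x * exp (- lambda s x^theta), so that the substitution
   t = lambda x^theta turns it into u' A u times a Laplace transform at s. *)

Require Import Defs.
From HB Require Import structures.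
From mathcomp Require Import all_boot all_order all_algebra.
From mathcomp Require Import all_classical all_reals all_analysis.
From mathcomp Require Import measurable_realfun ring.
Import Order.TTheory GRing.Theory Num.Theory.
Import numFieldNormedType.Exports.
Local Open Scope classical_set_scope.
Local Open Scope ring_scope.

Set Implicit Arguments.
Unset Strict Implicit.
Unset Printing Implicit Defensive.

(** * Measures given by a density *)

Section density_measure.
Local Open Scope ereal_scope.
Context d (T : measurableType d) (R : realType).
Variables (mu : {measure set T -> \bar R}) (w : T -> R).
Hypotheses (mw : measurable_fun setT w) (w0 : forall x, (0 <= w x)%R).

(* The two proof arguments are unused in the body: they let the measure
   instance be inferred. *)
Definition density_measure of measurable_fun setT w & (forall x, (0 <= w x)%R) :=
  fun A : set T => \int[mu]_(x in A) (w x)%:E.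

Local Notation nu := (density_measure mw w0).

Let mwE : measurable_fun setT (EFin \o w).
Proof. exact/measurable_EFinP. Qed.

Let w0E x : 0 <= (w x)%:E.
Proof. by rewrite lee_fin. Qed.

Let nu0 : nu set0 = 0.
Proof. by rewrite /density_measure integral_set0. Qed.

Let nu_ge0 A : 0 <= nu A.
Proof. by apply: integral_ge0 => x _. Qed.

Let nu_sigma_additive : semi_sigma_additive nu.
Proof.
move=> F mF tF mUF; rewrite /density_measure ge0_integral_bigcup//.
- by apply: is_cvg_ereal_nneg_natsum_cond => n _ _; exact: integral_ge0.
- exact: measurable_funTS.
Qed.

HB.instance Definition _ := isMeasure.Build _ _ _ nu
  nu0 nu_ge0 nu_sigma_additive.

Import HBNNSimple.

(** On an indicator the identity is the definition of the measure. Linearity extends it to the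
    simple functions [h n] increasing to [f], and monotone convergence on both sides passes to the
    limit. *)
Lemma ge0_integral_density (f : T -> \bar R) :
  measurable_fun setT f -> (forall x, 0 <= f x) ->
  \int[nu]_x f x = \int[mu]_x (f x * (w x)%:E).
Proof.
move=> mf f0.
pose h := nnsfun_approx measurableT mf.
have h_le n : \int[nu]_x (h n x)%:E = \int[mu]_x ((h n x)%:E * (w x)%:E).
  have fsum x : (h n x)%:E =
      \sum_(y \in range (h n)) (y * \1_(h n @^-1` [set y]) x)%:E.
    by rewrite fsumEFin// -fimfunE.
  transitivity (\sum_(y \in range (h n))
      \int[nu]_x (y * \1_(h n @^-1` [set y]) x)%:E).
    rewrite -ge0_integral_fsum//.
    - by apply: eq_integral => x _; exact: fsum.
    - by move=> y; exact/measurable_EFinP/measurable_funM.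
    - by move=> y x _; rewrite nnfun_muleindic_ge0.
  transitivity (\sum_(y \in range (h n))
      \int[mu]_x ((y * \1_(h n @^-1` [set y]) x)%:E * (w x)%:E)); last first.
    rewrite -ge0_integral_fsum//.
    - apply: eq_integral => x _; rewrite fsum ge0_mule_fsuml// => y.
      by rewrite nnfun_muleindic_ge0.
    - move=> y; apply: (emeasurable_funM _ mwE).
      exact/measurable_EFinP/measurable_funM.
    - by move=> y x _; rewrite mule_ge0// nnfun_muleindic_ge0.
  (* Only values attained by [h n] occur in the sum, so [y] is nonnegative and can be pulled out of
     the integral. *)
  apply: eq_fsbigr => y; rewrite inE => -[t _ yE].
  have y0 : (0 <= y)%R by rewrite -yE.
  rewrite integralZl_indic_nnsfun// integral_indic// setIT.
  under [RHS]eq_integral do rewrite EFinM -muleA.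
  rewrite ge0_integralZl//.
  - congr (_ * _); rewrite /density_measure [LHS]integral_mkcond.
    by apply: eq_integral => x _; rewrite epatch_indic muleC.
  - by apply: (emeasurable_funM _ mwE); exact/measurable_EFinP.
  - by move=> x _; rewrite mule_ge0// lee_fin.
transitivity (limn (fun n => \int[nu]_x (h n x)%:E)).
  rewrite -monotone_convergence//.
  - by apply: eq_integral => x _; apply/esym/cvg_lim => //;
      exact: cvg_nnsfun_approx.
  - by move=> n; exact/measurable_EFinP.
  - by move=> n x _; rewrite lee_fin.
  - by move=> x _ m n mn; rewrite lee_fin; exact/lefP/nd_nnsfun_approx.
under eq_fun do rewrite h_le.
rewrite -monotone_convergence//.
- apply: eq_integral => x _; apply/cvg_lim => //.
  by apply: cvgeZr => //; exact: cvg_nnsfun_approx.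
- move=> n; apply: (emeasurable_funM _ mwE); exact/measurable_EFinP.
- by move=> n x _; rewrite mule_ge0// lee_fin.
- by move=> x _ m n mn; rewrite lee_wpmul2r// lee_fin; exact/lefP/nd_nnsfun_approx.
Qed.

End density_measure.

(** * Change of variables on the positive half-line *)

Section substitution.
Local Open Scope ereal_scope.
Context (R : realType).
Local Notation leb := (@lebesgue_measure R).
Local Notation pos := (`]0%R, +oo[%classic : set R).

(** The measures may be infinite near 0 or at infinity. They are first compared on each [K n], where
    they are finite and half-open intervals form a generating class stable under intersection;
    continuity from below then lets [n] grow. *)
Lemma eq_measure_pos (m1 m2 : {measure set (measurableTypeR R) -> \bar R}) :
  (forall a b : R, (0 < a)%R -> m1 `]a, b]%classic = m2 `]a, b]%classic) ->
  (forall a b : R, (0 < a)%R -> m1 `]a, b]%classic < +oo) ->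
  forall E : set (measurableTypeR R), measurable E -> E `<=` pos -> m1 E = m2 E.
Proof.
move=> m12 m1oo E mE Epos.
pose K n : set (measurableTypeR R) := `](n.+1%:R^-1)%R, n.+1%:R]%classic.
have mK n : measurable (K n) by exact: measurable_itv.
(* Cutting an arbitrary half-open interval with [K n] moves its left end away from 0, where the
   hypotheses apply. *)
have KI n (a b : R) : exists c e : R,
    (0 < c)%R /\ `]a, b]%classic `&` K n = `]c, e]%classic.
  exists (Num.max a n.+1%:R^-1)%R, (Num.min b n.+1%:R)%R; split.
    by rewrite lt_max invr_gt0 ltr0n orbT.
  apply/seteqP; split => x /=; rewrite /K/= !in_itv/= gt_max le_min.
    by move=> [/andP[-> ->] /andP[-> ->]].
  by move=> /andP[/andP[-> ->] /andP[-> ->]].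
have EK n : m1 (E `&` K n) = m2 (E `&` K n).
  rewrite -[LHS]/(mrestr m1 (mK n) E) -[RHS]/(mrestr m2 (mK n) E).
  apply: (@measure_unique _ R (measurableTypeR R) (@ocitv R)
    (fun k => `](- k%:R)%R, k%:R]%classic)) => //.
  - exact: ocitvI.
  - by move=> k; exact: is_ocitv.
  - rewrite -subTset => x _ /=; exists (Num.truncn `|x|%R).+1 => //=.
    rewrite in_itv/=; have := truncnS_gt `|x|%R.
    by rewrite ltr_norml => /andP[-> /ltW ->].
  - move=> _ [[a b] _ <-] /=; have [c [e [c0 KE]]] := KI n a b.
    exact: etrans (congr1 m1 KE) (etrans (m12 c e c0) (esym (congr1 m2 KE))).
  - move=> k; have [c [e [c0 KE]]] := KI n (- k%:R)%R k%:R.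
    by apply: le_lt_trans (m1oo c e c0); rewrite -KE.
have UK : E = \bigcup_n (E `&` K n).
  rewrite -setI_bigcupr; apply/esym/setIidl => x /Epos /=.
  rewrite in_itv/= andbT => x0.
  (* This index makes [n.+1] exceed both [x] and its inverse. *)
  exists (maxn (Num.truncn x) (Num.truncn x^-1)) => //=; rewrite /K/= in_itv/=.
  apply/andP; split.
    rewrite invf_plt ?posrE//; apply: (lt_le_trans (truncnS_gt _)).
    by rewrite ler_nat ltnS leq_maxr.
  apply: (le_trans (ltW (truncnS_gt _))).
  by rewrite ler_nat ltnS leq_maxl.
have mEK n : measurable (E `&` K n) by exact: measurableI.
have ndK : nondecreasing_seq (fun n => E `&` K n).
  move=> n m nm; apply/subsetPset; apply: setIS => x; rewrite /K/= !in_itv/=.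
  move=> /andP[nx xn]; apply/andP; split.
    by apply: le_lt_trans nx; rewrite lef_pV2 ?posrE// ler_nat ltnS.
  by apply: (le_trans xn); rewrite ler_nat ltnS.
have mU : measurable (\bigcup_n (E `&` K n)) by rewrite -UK.
have c1 := nondecreasing_cvg_mu (mu := m1) mEK mU ndK.
have c2 := nondecreasing_cvg_mu (mu := m2) mEK mU ndK.
rewrite UK -(cvg_lim _ c1)// -(cvg_lim _ c2)//.
by apply/congr_lim/funext => n; exact: EK.
Qed.

(* chi is the inverse of the change of variables and F a primitive of w: it
   suffices to compare the push-forward by chi of the Lebesgue
   measure on J with the density w on the intervals ]a, b] away from 0. *)
Lemma ge0_integral_subst (chi w F : R -> R) (J : set R) (f : R -> \bar R) :
  measurable J -> measurable_fun setT chi ->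
  measurable_fun setT w -> (forall x, 0 <= w x)%R ->
  (forall z, J z -> 0 < chi z)%R ->
  (forall a b : R, (0 < a)%R -> (a <= b)%R ->
    leb (J `&` chi @^-1` `]a, b]) = (F b - F a)%:E) ->
  (forall a b : R, (0 < a)%R -> (a <= b)%R ->
    \int[leb]_(x in `]a, b]) (w x)%:E = (F b - F a)%:E) ->
  measurable_fun setT f -> (forall x, 0 <= f x) ->
  \int[leb]_(z in J) f (chi z) = \int[leb]_(x in pos) (f x * (w x)%:E).
Proof.
move=> mJ mchi mw w0 chi0 Jab wab mf f0.
have mposR : measurable pos by exact: measurable_itv.
have m1J : measurable_fun setT (\1_J : R -> R) by exact: measurable_indic.
have J0 x : (0 <= (\1_J x : R))%R by [].
have mfD : measurable_fun setT (f \_ pos).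
  by apply/(measurable_restrictT _ _).1 => //; exact: measurable_funTS.
have fD0 x : 0 <= (f \_ pos) x by rewrite patchE; case: ifPn.
have mfDchi : measurable_fun setT ((f \_ pos) \o chi) by exact: measurableT_comp.
(* The domain [J] is turned into the density [\1_J], and [f] is cut off outside [pos], so that both
   sides become integrals of one function over the whole line, against two measures to be
   compared. *)
transitivity (\int[leb]_z (((f \_ pos) \o chi) z * (\1_J z)%:E)).
  rewrite integral_mkcond; apply: eq_integral => z _ /=.
  rewrite epatch_indic /= indicE; have [/set_mem Jz|] := boolP (z \in J).
    have cz : pos (chi z) by rewrite /= in_itv/= andbT chi0.
    by rewrite patchE mem_set//= !mule1.
  by rewrite /= !mule0.
rewrite -(@ge0_integral_density _ _ _ leb _ m1J J0)//; last by move=> x; exact: fD0.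
rewrite -[X in \int[_]_(z in X) _ = _](preimage_setT chi).
rewrite -(@ge0_integral_pushforward _ _ (measurableTypeR R) (measurableTypeR R)
  R chi mchi (density_measure leb m1J J0))//.
transitivity (\int[density_measure leb mw w0]_y (f \_ pos) y).
  rewrite -[LHS]integral_mkcond -[RHS]integral_mkcond.
  apply: eq_measure_integral => E mE EP.
  have pushE (a b : R) : density_measure leb m1J J0 (chi @^-1` `]a, b]) =
      leb (J `&` chi @^-1` `]a, b]).
    rewrite /density_measure integral_indic//.
    by rewrite -[X in measurable X]setTI; exact: mchi.
  apply: eq_measure_pos => //.
  - move=> a b a0; have [ab|ba] := leP a b; last first.
      by rewrite set_itv_ge ?bnd_simp -?leNgt ?ltW// !measure0.
    by rewrite [RHS]wab// -Jab// -pushE.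
  - move=> a b a0; have [ab|ba] := leP a b; last first.
      by rewrite set_itv_ge ?bnd_simp -?leNgt ?ltW// measure0.
    by rewrite [X in X < _]pushE Jab// ltry.
rewrite ge0_integral_density// [RHS]integral_mkcond.
apply: eq_integral => x _; rewrite !patchE; case: ifPn => //.
by rewrite mul0e.
Qed.

End substitution.

(** * Substitutions by powers and their primitives *)

Section power_substitution.
Local Open Scope ereal_scope.
Context (R : realType).
Local Notation leb := (@lebesgue_measure R).
Local Notation pos := (`]0%R, +oo[%classic : set R).

Lemma integral_derivative_pos (F w : R -> R) :
  (forall x : R, (0 < x)%R -> is_derive x (1%R : R) F (w x)) ->
  (forall x : R, (0 < x)%R -> {for x, continuous w}) ->
  forall a b : R, (0 < a)%R -> (a <= b)%R -> measurable_fun setT w ->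
  \int[leb]_(x in `]a, b]) (w x)%:E = (F b - F a)%:E.
Proof.
move=> dF cw a b a0 + mw; rewrite le_eqVlt => /predU1P[<-|ab].
  by rewrite set_itv_ge ?bnd_simp// integral_set0 subrr.
rewrite integral_itv_obnd_cbnd; last exact/measurable_EFinP/measurable_funTS.
have cF x : (0 < x)%R -> {for x, continuous F}.
  move=> x0; apply: differentiable_continuous; apply/derivable1_diffP.
  by have [] := dF x x0.
have b0 := lt_trans a0 ab.
rewrite (@continuous_FTC2 _ w F)//.
- apply: continuous_in_subspaceT => x; rewrite inE/= in_itv/= => /andP[ax _].
  exact/cw/lt_le_trans/ax.
- split.
  + move=> x; rewrite in_itv/= => /andP[ax _].
    by have [] := dF x (lt_trans a0 ax).
  + exact/cvg_at_right_filter/cF.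
  + exact/cvg_at_left_filter/cF.
- move=> x; rewrite in_itv/= => /andP[ax _].
  by rewrite derive1E; have [] := dF x (lt_trans a0 ax).
Qed.

Lemma continuous_powR_pos (p x : R) : (0 < x)%R ->
  {for x, continuous (@powR R ^~ p)}.
Proof.
move=> x0; apply: differentiable_continuous; apply/derivable1_diffP.
by have [] := is_derive1_powR p x0.
Qed.

Lemma powRK_pos (p x : R) : (0 < p)%R -> (0 <= x)%R -> ((x `^ p) `^ p^-1 = x)%R.
Proof. by move=> p0 x0; rewrite -powRrM divff ?gt_eqF// powRr1. Qed.

Lemma powRVK_pos (p x : R) : (0 < p)%R -> (0 <= x)%R -> ((x `^ p^-1) `^ p = x)%R.
Proof. by move=> p0 x0; rewrite -powRrM mulVf ?gt_eqF// powRr1. Qed.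

Lemma ltr_powR2 (p x y : R) : (0 < p)%R -> (0 <= x)%R -> (0 <= y)%R ->
  (x `^ p < y `^ p)%R = (x < y)%R.
Proof.
move=> p0 x0 y0; apply/idP/idP; last by apply: gt0_ltr_powR; rewrite ?nnegrE.
apply: contraTT; rewrite -!leNgt => yx.
by apply: ge0_ler_powR; rewrite ?nnegrE// ltW.
Qed.

Lemma ltr_powRV (p x y : R) : (0 < p)%R -> (0 <= x)%R -> (0 <= y)%R ->
  (x < y `^ p^-1)%R = (x `^ p < y)%R.
Proof.
by move=> p0 x0 y0; rewrite -[RHS](@ltr_powR2 p^-1) ?invr_gt0 ?powR_ge0// powRK_pos.
Qed.

Lemma ler_powRV (p x y : R) : (0 < p)%R -> (0 <= x)%R -> (0 <= y)%R ->
  (y `^ p^-1 <= x)%R = (y <= x `^ p)%R.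
Proof. by move=> p0 x0 y0; rewrite leNgt ltr_powRV// -leNgt. Qed.

(** The substitution is y = c x^p. It is increasing and is itself a primitive of the weight, so the
    preimage of an interval under the inverse map has length equal to the increment of that
    primitive. *)
Lemma ge0_integral_powR_subst (c p : R) (f : R -> \bar R) :
  (0 < c)%R -> (0 < p)%R ->
  measurable_fun setT f -> (forall x, 0 <= f x) ->
  \int[leb]_(y in pos) f ((y / c) `^ p^-1)%R =
  \int[leb]_(x in pos) (f x * (c * (p * x `^ (p - 1)))%:E).
Proof.
move=> c0 p0 mf f0.
have mw : measurable_fun setT (fun x : R => c * (p * x `^ (p - 1)))%R.
  by do 2 apply: measurable_funM => //; exact: measurable_powR.
apply: (@ge0_integral_subst R (fun y => (y / c) `^ p^-1)%R _
  (fun x => c * x `^ p)%R) => //.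
- have mdiv : measurable_fun setT (fun y : R => y / c)%R by exact: measurable_funM.
  exact: (measurableT_comp (measurable_powR p^-1) mdiv).
- by move=> x; rewrite !mulr_ge0 ?powR_ge0 ?ltW.
- by move=> y; rewrite /= in_itv/= andbT => y0; rewrite powR_gt0 ?divr_gt0.
- move=> a b a0 ab; have b0 := lt_le_trans a0 ab.
  rewrite (_ : _ `&` _ = `](c * a `^ p)%R, (c * b `^ p)%R]%classic); last first.
    apply/seteqP; split => y /=; rewrite !in_itv/= ?andbT.
      move=> [y0].
      rewrite (ltr_powRV p0 (ltW a0) (ltW (divr_gt0 y0 c0))).
      rewrite (ler_powRV p0 (ltW b0) (ltW (divr_gt0 y0 c0))).
      by rewrite ltr_pdivlMr// ler_pdivrMr// ![(_ * c)%R]mulrC.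
    move=> /andP[ay yb].
    have y0 : (0 < y)%R by apply: lt_trans ay; rewrite mulr_gt0 ?powR_gt0.
    split => //.
    rewrite (ltr_powRV p0 (ltW a0) (ltW (divr_gt0 y0 c0))).
    rewrite (ler_powRV p0 (ltW b0) (ltW (divr_gt0 y0 c0))).
    by rewrite ltr_pdivlMr// ler_pdivrMr// ![(_ * c)%R]mulrC ay.
  rewrite lebesgue_measure_itv/= lte_fin.
  have : (c * a `^ p <= c * b `^ p)%R.
    by rewrite ler_pM2l//; apply: ge0_ler_powR; rewrite ?nnegrE// ltW.
  by case: ltgtP => // -> _; rewrite subrr.
- move=> a b a0 ab; apply: (@integral_derivative_pos (fun x => c * x `^ p)%R) => // x x0.
    have dp := is_derive1_powR p x0.
    exact: is_deriveZ.
  apply: continuousM; first exact: cst_continuous.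
  apply: continuousM; first exact: cst_continuous.
  exact: continuous_powR_pos.
Qed.

(** On each side of 0 the inverse is a power with exponent -1, up to sign; at 0 both the power and
    the inverse are 0 by convention. *)
Lemma measurable_inv : measurable_fun setT (fun x : R => x^-1%R).
Proof.
rewrite (_ : (fun _ => _) =
  fun x : R => if (x < 0)%R then (- ((- x) `^ (-1)))%R else (x `^ (-1))%R).
  apply: measurable_fun_ifT; first exact: measurable_fun_ltr.
    apply: measurableT_comp => //.
    exact: (measurableT_comp (measurable_powR (-1)) (@oppr_measurable R setT)).
  exact: measurable_powR.
apply/funext => x; case: ifPn => [x0|]; last by rewrite -leNgt => /powR_inv1.
by rewrite powR_inv1 ?invrN ?opprK// oppr_ge0 ltW.
Qed.

Lemma measurable_funV d (T : measurableType d) (f : T -> R) :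
  measurable_fun setT f -> measurable_fun setT (fun x => (f x)^-1%R).
Proof. exact: (measurableT_comp measurable_inv). Qed.

Lemma measurable_inv1_powR (q : R) :
  measurable_fun setT (fun z : R => (z^-1 - 1) `^ q)%R.
Proof.
apply: (measurableT_comp (measurable_powR q)).
exact: measurable_funB measurable_inv _.
Qed.

(** The substitution is z = 1 / (x^p + 1), a decreasing bijection from the positive half-line onto
    the unit interval. The primitive of the weight is therefore its opposite. *)
Lemma ge0_integral_inv1_powR_subst (p : R) (f : R -> \bar R) :
  (0 < p)%R ->
  measurable_fun setT f -> (forall x, 0 <= f x) ->
  \int[leb]_(z in `]0%R, 1%R[) f ((z^-1 - 1) `^ p^-1)%R =
  \int[leb]_(x in pos) (f x * (p * x `^ (p - 1) / (x `^ p + 1) ^+ 2)%:E).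
Proof.
move=> p0 mf f0.
have G0 (x : R) : (0 < x `^ p + 1)%R by rewrite ltr_wpDl ?powR_ge0.
have mw : measurable_fun setT
    (fun x : R => p * x `^ (p - 1) / (x `^ p + 1) ^+ 2)%R.
  apply: measurable_funM.
    by apply: measurable_funM => //; exact: measurable_powR.
  apply: measurable_funV; apply: measurable_funX.
  by apply: measurable_funD => //; exact: measurable_powR.
apply: (@ge0_integral_subst R (fun z => (z^-1 - 1) `^ p^-1)%R _
  (fun x => - (x `^ p + 1)^-1)%R) => //.
- exact: measurable_inv1_powR.
- by move=> x; rewrite divr_ge0 ?mulr_ge0 ?powR_ge0 ?sqr_ge0// ltW.
- move=> z; rewrite /= in_itv/= => /andP[z0 z1].
  by rewrite powR_gt0// subr_gt0 invf_gt1.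
- move=> a b a0 ab; have b0 := lt_le_trans a0 ab.
  (* The map decreases, so the endpoints are swapped and the closed end changes side. *)
  rewrite (_ : _ `&` _ = `[(b `^ p + 1)^-1, (a `^ p + 1)^-1[%classic)%R;
      last first.
    have chiE (z : R) : (0 < z < 1)%R ->
        (a < (z^-1 - 1) `^ p^-1 <= b)%R =
        ((b `^ p + 1)^-1 <= z < (a `^ p + 1)^-1)%R.
      move=> /andP[z0 z1].
      have zV0 : (0 <= z^-1 - 1)%R by rewrite subr_ge0 ltW// invf_gt1.
      rewrite (ltr_powRV p0 (ltW a0) zV0).
      rewrite (ler_powRV p0 (ltW b0) zV0) ltrBrDr lerBlDr.
      rewrite -(invrK (a `^ p + 1)%R) ltf_pV2 ?posrE ?invr_gt0//.
      by rewrite -{1}(invrK (b `^ p + 1)%R) lef_pV2 ?posrE ?invr_gt0// andbC invrK.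
    apply/seteqP; split => z /=; rewrite !in_itv/=.
      by move=> [z01]; rewrite chiE.
    move=> bza; suff z01 : (0 < z < 1)%R by split => //; rewrite chiE.
    move: bza => /andP[bz za]; apply/andP; split.
      by apply: lt_le_trans bz; rewrite invr_gt0.
    by apply: (lt_trans za); rewrite invf_lt1// ltrDr powR_gt0.
  rewrite lebesgue_measure_itv/= lte_fin.
  rewrite (_ : (_ - - _)%R = (a `^ p + 1)^-1 - (b `^ p + 1)^-1)%R; last first.
    by rewrite opprK addrC.
  have : ((b `^ p + 1)^-1 <= (a `^ p + 1)^-1)%R.
    by rewrite lef_pV2 ?posrE// lerD2r; apply: ge0_ler_powR; rewrite ?nnegrE// ltW.
  by case: (ltgtP (b `^ p + 1)^-1 (a `^ p + 1)^-1)%R => // -> _; rewrite subrr.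
- move=> a b a0 ab.
  apply: (@integral_derivative_pos (fun x => - (x `^ p + 1)^-1)%R
    (fun x => p * x `^ (p - 1) / (x `^ p + 1) ^+ 2)%R) => // x x0.
    have dp := is_derive1_powR p x0.
    have dG : is_derive x 1%R (fun x : R => x `^ p + 1)%R (p * x `^ (p - 1))%R.
      by apply: is_derive_eq; rewrite addr0.
    have dV := is_deriveN (@is_deriveV _ (fun x : R => x `^ p + 1)%R _ _ _
      (lt0r_neq0 (G0 x)) dG).
    by apply: (is_derive_eq dV); rewrite scaleNr opprK [RHS]mulrC.
  apply: continuousM.
    apply: continuousM; first exact: cst_continuous.
    exact: continuous_powR_pos.
  apply: continuousV; first by rewrite expf_neq0// gt_eqF.
  apply: (@continuous_comp _ _ _ (fun y : R => y `^ p + 1)%R (fun y : R => y ^+ 2)%R);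
    last exact: exprn_continuous.
  apply: continuousD; last exact: cst_continuous.
  exact: continuous_powR_pos.
Qed.

End power_substitution.

(** * The joint law of two independent variables *)

Section joint_law.
Local Open Scope ereal_scope.
Context d (T : measurableType d) (R : realType) (P : probability T R).
Local Notation leb := (@lebesgue_measure R).

(** Independence says that the law of the pair agrees with the product of the marginal laws on
    rectangles, hence everywhere by uniqueness of product measures. The product measure is then
    computed by sections, and each marginal law replaced by its density. *)
Lemma indep2_joint_law (X Y : {RV P >-> R}) (fX fY : R -> R) (C : set (R * R)) :
  indep2 P X Y -> is_density P X fX -> is_density P Y fY -> measurable C ->
  P [set w | C (X w, Y w)] =
  \int[leb]_x ((\int[leb]_(y in xsection C x) (fY y)%:E) * (fX x)%:E).
Proof.
move=> XY [fX0 [mfX PX]] [fY0 [mfY PY]] mC.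
have mXY : measurable_fun setT (fun w => (X w, Y w)).
  exact: measurable_fun_pair.
have -> : P [set w | C (X w, Y w)] = (distribution P X \x distribution P Y) C.
  apply/esym/(@product_measure_unique _ _ _ _ R (distribution P X)
    (distribution P Y) (pushforward P (fun w => (X w, Y w)))) => //.
rewrite /product_measure1.
transitivity (\int[density_measure leb mfX fX0]_x
    (distribution P Y \o xsection C) x).
  rewrite ge0_integral_distribution//; last exact: measurable_fun_xsection.
  rewrite -[X in \int[_]_(x in X) _](preimage_setT X).
  (* the cast selects the sigma-algebra instance carrying lebesgue_measure *)
  have mX : measurable_fun setT (X : T -> measurableTypeR R) by exact: (measurable_funP X).
  rewrite -(@ge0_integral_pushforward _ _ T (measurableTypeR R) R X mX P)//; last first.
    exact: measurable_fun_xsection.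
  apply: eq_measure_integral => E mE _.
  by rewrite [LHS]PX.
rewrite ge0_integral_density//.
  by apply: eq_integral => x _; congr (_ * _); rewrite -PY//; exact: measurable_xsection.
exact: measurable_fun_xsection.
Qed.

End joint_law.

(** * The transformed law of [Z] and the kernel of the ratio *)

Section ratio.
Local Open Scope ereal_scope.
Context (R : realType).
Local Notation leb := (@lebesgue_measure R).
Local Notation pos := (`]0%R, +oo[%classic : set R).

(** Each set is included in the union of the other one with [N], so subadditivity gives both
    inequalities. *)
Lemma eq_measure_off_negligible d (T : measurableType d)
    (mu : {measure set T -> \bar R}) (S1 S2 N : set T) :
  measurable S1 -> measurable S2 -> measurable N -> mu N = 0 ->
  (forall w, ~ N w -> S1 w <-> S2 w) -> mu S1 = mu S2.
Proof.
have le (A B : set T) : measurable A -> measurable B -> measurable N ->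
    mu N = 0 -> (forall w, ~ N w -> A w -> B w) -> mu A <= mu B.
  move=> mA mB mN N0 AB; rewrite -[leRHS]adde0 -N0.
  apply: le_trans (measureU2 _ mB mN); apply: le_measure; rewrite ?inE//.
    exact: measurableU.
  by move=> w Aw; have [Nw|/AB/(_ Aw)] := pselect (N w); [right|left].
move=> mS1 mS2 mN N0 S12; apply/eqP; rewrite eq_le; apply/andP.
by split; apply: le => // w /S12[].
Qed.

(** This is the first computation of the density of S, with [p] standing for 1 / theta: the density
    of [Z] is transported by z = 1 / (s^p + 1). *)
Lemma integral_inv1_powR_density d (T : measurableType d) (P : probability T R)
    (Z : T -> R) (fZ : R -> R) (p : R) (E : set R) :
  is_density P Z fZ -> (0 < p)%R -> measurable E -> E `<=` pos ->
  P (Z @^-1` (`]0%R, 1%R[ `&` (fun z => (z^-1 - 1) `^ p^-1)%R @^-1` E)) =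
  \int[leb]_(s in E)
    (fZ (s `^ p + 1)^-1 * (p * s `^ (p - 1) / (s `^ p + 1) ^+ 2))%:E.
Proof.
move=> [fZ0 [mfZ PZ]] p0 mE Epos.
have mchi : measurable_fun setT (fun z : R => (z^-1 - 1) `^ p^-1)%R.
  exact: measurable_inv1_powR.
have mA : measurable (`]0%R, 1%R[ `&` (fun z => (z^-1 - 1) `^ p^-1)%R @^-1` E).
  apply: measurableI; first exact: measurable_itv.
  by rewrite -[X in measurable X]setTI; exact: mchi.
(* Chosen so that, evaluated at (1/z - 1)^(1/p), it gives back [fZ z] exactly when that point lies
   in [E]. *)
pose f (s : R) := (\1_E s * fZ (s `^ p + 1)^-1)%:E.
have f0 s : 0 <= f s by rewrite lee_fin mulr_ge0.
have mf : measurable_fun setT f.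
  apply/measurable_EFinP/measurable_funM; first exact: measurable_indic.
  apply: (measurableT_comp mfZ); apply: measurable_funV.
  by apply: measurable_funD => //; exact: measurable_powR.
rewrite PZ// integral_mkcondr.
transitivity (\int[leb]_(z in `]0%R, 1%R[) f ((z^-1 - 1) `^ p^-1)%R).
  apply: eq_integral => z; rewrite inE/= in_itv/= => /andP[z0 z1].
  rewrite /f powRVK_pos// ?subr_ge0 ?invf_ge1 ?ltW//.
  rewrite subrK invrK patchE indicE.
  have -> : (z \in (fun z => (z^-1 - 1) `^ p^-1)%R @^-1` E) =
      (((z^-1 - 1) `^ p^-1)%R \in E) by apply/idP/idP; rewrite !inE.
  by case: ifPn; rewrite ?mul1r ?mul0r.
rewrite ge0_integral_inv1_powR_subst// -[in RHS](setIidr Epos) integral_mkcondr.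
apply: eq_integral => s _; rewrite patchE /f indicE.
by case: ifPn; rewrite ?mul1r// ?mul0r mul0e.
Qed.

Variables (fX fY : R -> R) (p : R).

(* Its integral over x is the density at s of (Y / X) `^ p^-1. *)
Definition ratio_kernel (x s : R) : R :=
  \1_pos x * \1_pos s * (fX x * fY (x * s `^ p) * (x * (p * s `^ (p - 1)))).

Hypotheses (fX0 : forall x, (0 <= fX x)%R) (fY0 : forall x, (0 <= fY x)%R)
  (p0 : (0 < p)%R).

Lemma ratio_kernel_ge0 x s : (0 <= ratio_kernel x s)%R.
Proof.
rewrite /ratio_kernel indicE; have [|_] := boolP (x \in _); last by rewrite !mul0r.
rewrite inE/= in_itv/= andbT => x0; rewrite mul1r mulr_ge0//.
by rewrite !mulr_ge0 ?powR_ge0 // ltW.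
Qed.

Hypotheses (mfX : measurable_fun setT fX) (mfY : measurable_fun setT fY).

Lemma measurable_ratio_kernel :
  measurable_fun setT (fun xs : R * R => ratio_kernel xs.1 xs.2).
Proof.
have m1 : measurable_fun setT (fun xs : R * R => xs.1) by exact: measurable_fst.
have m2 : measurable_fun setT (fun xs : R * R => xs.2) by exact: measurable_snd.
have mpos : measurable_fun setT (\1_pos : R -> R).
  by apply: measurable_indic; exact: measurable_itv.
have mp (q : R) : measurable_fun setT (fun xs : R * R => xs.2 `^ q)%R.
  exact: (measurableT_comp (measurable_powR q) m2).
apply: measurable_funM.
  by apply: measurable_funM;
    [exact: (measurableT_comp mpos m1)|exact: (measurableT_comp mpos m2)].
apply: measurable_funM.
  apply: measurable_funM; first exact: (measurableT_comp mfX m1).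
  by apply: (measurableT_comp mfY); exact: measurable_funM.
by apply: measurable_funM => //; exact: measurable_funM.
Qed.

End ratio.

(** * Two expressions for the density of (Y / X)^(1/p) *)

Section ratio_density.
Local Open Scope ereal_scope.
Context d (T : measurableType d) (R : realType) (P : probability T R).
Local Notation leb := (@lebesgue_measure R).
Local Notation pos := (`]0%R, +oo[%classic : set R).
Variables (X Y Z : {RV P >-> R}) (fX fY fZ : R -> R) (p : R).
Hypotheses (X0 : as_positive P X) (Y0 : as_positive P Y).
Hypotheses (dX : is_density P X fX) (dY : is_density P Y fY)
  (dZ : is_density P Z fZ).
Hypotheses (XY : indep2 P X Y)
  (ZXY : eq_in_dist P Z (fun w => X w / (X w + Y w))%R) (p0 : (0 < p)%R).

Let fX0 : forall x, (0 <= fX x)%R. Proof. by have [] := dX. Qed.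
Let fY0 : forall x, (0 <= fY x)%R. Proof. by have [] := dY. Qed.
Let mfX : measurable_fun setT fX. Proof. by have [_ []] := dX. Qed.
Let mfY : measurable_fun setT fY. Proof. by have [_ []] := dY. Qed.

(** Positivity of both coordinates is built in, so that the quotient is genuine and the sections at
    nonpositive abscissae are empty. *)
Let C (E : set R) : set (R * R) :=
  [set xy | (0 < xy.1)%R && (0 < xy.2)%R /\ E ((xy.2 / xy.1) `^ p^-1)%R].

Let measurable_C E : measurable E -> measurable (C E).
Proof.
move=> mE.
have m1 : measurable_fun setT (fun xs : R * R => xs.1) by exact: measurable_fst.
have m2 : measurable_fun setT (fun xs : R * R => xs.2) by exact: measurable_snd.
rewrite (_ : C E = (fst @^-1` pos `&` snd @^-1` pos) `&`
    (fun xy : R * R => (xy.2 / xy.1) `^ p^-1)%R @^-1` E); last first.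
  apply/seteqP; split=> -[x y]; rewrite /C/= !in_itv/= !andbT.
    by move=> [/andP[-> ->]].
  by move=> [[-> ->]].
apply: measurableI; first apply: measurableI.
- by rewrite -[X in measurable X]setTI; apply: m1 => //; exact: measurable_itv.
- by rewrite -[X in measurable X]setTI; apply: m2 => //; exact: measurable_itv.
- rewrite -[X in measurable X]setTI.
  suff mh : measurable_fun setT (fun xy : R * R => (xy.2 / xy.1) `^ p^-1)%R.
    exact: mh.
  apply: (measurableT_comp (measurable_powR p^-1)).
  by apply: measurable_funM => //; exact: measurable_funV.
Qed.

(** Where [X] and [Y] are both positive, z = X / (X + Y) lies in the unit interval and 1/z - 1 = Y /
    X, so the two events coincide. The remaining outcomes form a null set. *)
Let event_ratioE E : measurable E ->
  P ((fun w => X w / (X w + Y w))%R @^-1`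
      (`]0%R, 1%R[ `&` (fun z => (z^-1 - 1) `^ p^-1)%R @^-1` E)) =
  P [set w | C E (X w, Y w)].
Proof.
move=> mE.
have mX : measurable_fun setT X by exact: measurable_funP.
have mY : measurable_fun setT Y by exact: measurable_funP.
have mchi : measurable_fun setT (fun z : R => (z^-1 - 1) `^ p^-1)%R.
  exact: measurable_inv1_powR.
have mq : measurable_fun setT (fun w => X w / (X w + Y w))%R.
  apply: measurable_funM => //; apply: measurable_funV.
  exact: measurable_funD.
have mNX (V : {RV P >-> R}) : measurable [set w | (V w <= 0)%R].
  rewrite (_ : [set w | _] = V @^-1` `]-oo, 0%R]); last first.
    by apply/seteqP; split => w /=; rewrite in_itv.
  by rewrite -[X in measurable X]setTI; apply: (measurable_funP V) => //;
    exact: measurable_itv.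
apply: (@eq_measure_off_negligible _ _ _ P _ _
  ([set w | X w <= 0]%R `|` [set w | Y w <= 0]%R)).
- rewrite -[X in measurable X]setTI; apply: mq => //.
  apply: measurableI; first exact: measurable_itv.
  by rewrite -[X in measurable X]setTI; exact: mchi.
- rewrite -[X in measurable X]setTI.
  have mXY : measurable_fun setT (fun w => (X w, Y w)).
    exact: measurable_fun_pair.
  exact: (mXY _ _ (measurable_C mE)).
- exact: measurableU.
- apply/eqP; rewrite eq_le measure_ge0 andbT.
  apply: le_trans (measureU2 _ _ _) _ => //.
  by rewrite [V in V + _ <= _]X0 [V in _ + V <= _]Y0 adde0.
- move=> w; rewrite /= => /not_orP[/negP + /negP].
  rewrite -!ltNge => Xw Yw; rewrite /C/= Xw Yw in_itv/=.
  have XYw : (0 < X w + Y w)%R by rewrite addr_gt0.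
  have -> : ((X w / (X w + Y w))^-1 - 1 = Y w / X w)%R.
    by rewrite invf_div mulrDl divff ?gt_eqF// addrAC subrr add0r.
  rewrite divr_gt0// ltr_pdivrMr// mul1r ltrDl Yw.
  by split => -[].
Qed.

(** This is the second computation of the density of S. For fixed positive x, the substitution y = x
    s^p turns the integral over the section into one over s; Tonelli's theorem then exchanges s and
    x. *)
Let integral_ratio_kernel E : measurable E -> E `<=` pos ->
  P [set w | C E (X w, Y w)] =
  \int[leb]_(s in E) \int[leb]_x (ratio_kernel fX fY p x s)%:E.
Proof.
move=> mE Epos; have mposR : measurable pos by exact: measurable_itv.
have mG := measurable_ratio_kernel p mfX mfY.
have G0 := ratio_kernel_ge0 fX0 fY0 p0.
rewrite (indep2_joint_law XY dX dY (measurable_C mE)).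
pose K (xs : measurableTypeR R * measurableTypeR R) : \bar R :=
  (\1_E xs.2 * ratio_kernel fX fY p xs.1 xs.2)%:E.
have mK : measurable_fun setT K.
  apply/measurable_EFinP/measurable_funM => //.
  have m1E : measurable_fun setT (\1_E : R -> R) by exact: measurable_indic.
  by apply: (measurableT_comp m1E); exact: measurable_snd.
have K0 xs : 0 <= K xs by rewrite lee_fin mulr_ge0.
transitivity (\int[leb]_x \int[leb]_s K (x, s)).
  apply: eq_integral => x _.
  (* For nonpositive [x] both sides vanish: the section of [C E] is empty and the kernel carries the
     factor [\1_pos x]. *)
  have [x0|x0] := leP x 0%R.
    rewrite [X in X * _](_ : _ = 0); last first.
      rewrite (_ : xsection _ _ = set0) ?integral_set0//.
      apply/seteqP; split => y //; rewrite /xsection/= inE /C/=.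
      by rewrite ltNge x0 => -[].
    rewrite mul0e integral0_eq// => s _.
    have xpos : (x \in pos) = false by apply: memNset; rewrite /= in_itv/= ltNge x0.
    by rewrite /K /ratio_kernel /= [\1_pos x]indicE xpos !mul0r mulr0.
  pose f (s : R) := (\1_E s * fY (x * s `^ p))%:E.
  have f0 s : 0 <= f s by rewrite lee_fin mulr_ge0.
  have mf : measurable_fun setT f.
    apply/measurable_EFinP/measurable_funM; first exact: measurable_indic.
    apply: (measurableT_comp mfY).
    by apply: measurable_funM => //; exact: measurable_powR.
  have -> : \int[leb]_(y in xsection (C E) x) (fY y)%:E =
      \int[leb]_(y in pos) f ((y / x) `^ p^-1)%R.
    rewrite [LHS]integral_mkcond [RHS]integral_mkcond.
    apply: eq_integral => y _; rewrite !patchE mem_xsection.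
    have [y0|y0] := ltP 0%R y; last first.
      have yC : ((x, y) \in C E) = false.
        by apply: memNset; rewrite /C/= [(0 < y)%R]ltNge y0 andbF => -[].
      have ypos : (y \in pos) = false by apply: memNset; rewrite /= in_itv/= ltNge y0.
      by rewrite yC ypos.
    have ypos : y \in pos by rewrite inE/= in_itv/= y0.
    rewrite ypos.
    rewrite /f powRVK_pos ?divr_ge0 ?ltW// mulrCA divff ?gt_eqF// mulr1 indicE.
    have -> : ((x, y) \in C E) = ((y / x) `^ p^-1 \in E)%R.
      by apply/idP/idP; rewrite !inE /C/= x0 y0 => // -[].
    by case: ifPn; rewrite ?mul1r ?mul0r.
  rewrite ge0_integral_powR_subst//.
  have mfw : measurable_fun pos (fun s => f s * (x * (p * s `^ (p - 1)))%:E).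
    apply: measurable_funTS; apply: emeasurable_funM => //.
    apply/measurable_EFinP; do 2 apply: measurable_funM => //.
  rewrite -ge0_integralZr ?lee_fin//; last first.
    by move=> s _; rewrite mule_ge0// lee_fin !mulr_ge0 ?powR_ge0// ltW.
  rewrite integral_mkcond; apply: eq_integral => s _.
  rewrite epatch_indic /K /f /ratio_kernel -!EFinM/=; congr EFin.
  have xpos : x \in pos by rewrite inE/= in_itv/= x0.
  rewrite [\1_pos x]indicE xpos /=.
  by ring.
rewrite (fubini_tonelli (m1 := leb) (m2 := leb) K mK K0).
rewrite [RHS]integral_mkcond; apply: eq_integral => s _.
rewrite patchE; case: ifPn => sE.
  by apply: eq_integral => x _; rewrite /K/= indicE sE mul1r.
by rewrite integral0_eq// => x _; rewrite /K/= indicE (negbTE sE) mul0r.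
Qed.

(** Over every measurable subset [E] of [pos], both sides integrate to the probability of the event
    given by [C E]. Such integrals determine an integrable function almost everywhere. *)
Lemma ratio_density_ae : {ae leb, forall s, pos s ->
  (fZ (s `^ p + 1)^-1 * (p * s `^ (p - 1) / (s `^ p + 1) ^+ 2))%:E =
  \int[leb]_x (ratio_kernel fX fY p x s)%:E}.
Proof.
have mposR : measurable pos by exact: measurable_itv.
have PE (E : set R) : measurable E -> E `<=` pos ->
    \int[leb]_(s in E)
      (fZ (s `^ p + 1)^-1 * (p * s `^ (p - 1) / (s `^ p + 1) ^+ 2))%:E =
    P [set w | C E (X w, Y w)].
  move=> mE Epos; rewrite -(integral_inv1_powR_density dZ p0 mE Epos).
  rewrite ZXY ?event_ratioE//; apply: measurableI; first exact: measurable_itv.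
  rewrite -[X in measurable X]setTI.
  exact: (@measurable_inv1_powR R p^-1).
have [fZ0 [mfZ _]] := dZ.
have mp (q : R) : measurable_fun setT (fun s : R => s `^ q)%R.
  exact: measurable_powR.
have mVp : measurable_fun setT (fun s : R => (s `^ p + 1)^-1)%R.
  by apply: measurable_funV; exact: measurable_funD.
have mq : measurable_fun setT (fun s : R =>
    fZ (s `^ p + 1)^-1 * (p * s `^ (p - 1) / (s `^ p + 1) ^+ 2))%R.
  apply: measurable_funM; first exact: (measurableT_comp mfZ mVp).
  apply: measurable_funM; first exact: measurable_funM.
  by apply: measurable_funV; apply: measurable_funX; exact: measurable_funD.
apply: integral_ae_eq => //.
(* The function is nonnegative and its integral over [pos] is a probability, hence finite. *)
- apply/integrableP; split; first exact/measurable_EFinP/measurable_funTS.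
  under eq_integral.
    move=> s _; rewrite gee0_abs; last first.
      rewrite lee_fin mulr_ge0// divr_ge0 ?sqr_ge0// mulr_ge0 ?powR_ge0//.
      exact: ltW.
    over.
  rewrite PE//; apply: le_lt_trans (ltry 1).
  apply: probability_le1; rewrite -[X in measurable X]setTI.
  have mXY : measurable_fun setT (fun w => (X w, Y w)).
    exact: measurable_fun_pair.
  exact: (mXY _ _ (measurable_C mposR)).
- apply: measurable_funTS.
  apply: (@measurable_fun_fubini_tonelli_G _ _ (measurableTypeR R)
    (measurableTypeR R) R leb (fun xs => (ratio_kernel fX fY p xs.1 xs.2)%:E)).
    by apply/measurable_EFinP; exact: (measurable_ratio_kernel p mfX mfY).
  by move=> x; rewrite lee_fin ratio_kernel_ge0.
- by move=> E Epos mE; rewrite -integral_ratio_kernel// -PE.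
Qed.

End ratio_density.

(** * Laplace transforms after the substitution t = lambda x^theta *)

Section laplace_powR.
Context (R : realType).
Variables (lambda theta : R) (k : R -> R).
Hypotheses (l0 : 0 < lambda) (t0 : 0 < theta).
Hypotheses (mk : measurable_fun setT k) (k0 : forall x, 0 <= k x).

Let mexp (s : R) (h : R -> R) : measurable_fun setT h ->
  measurable_fun setT (fun t => expR (- (s * h t))).
Proof.
move=> mh; have msh : measurable_fun setT (fun t => s * h t).
  exact: measurable_funM.
have mNsh : measurable_fun setT (fun t => - (s * h t)).
  exact: (measurableT_comp (@oppr_measurable R setT) msh).
exact: (measurableT_comp (@measurable_expR R) mNsh).
Qed.

Let mf (s : R) :
  measurable_fun setT (fun x => expR (- (s * (lambda * x `^ theta))) * k x).
Proof.
apply: (measurable_funM (mexp s (h := fun x => lambda * x `^ theta) _) mk).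
by apply: measurable_funM => //; exact: measurable_powR.
Qed.

Let f0 (s x : R) :
  (0 <= (expR (- (s * (lambda * x `^ theta))) * k x)%:E)%E.
Proof. by rewrite lee_fin mulr_ge0 ?expR_ge0. Qed.

Lemma measurable_laplace_powR_integrand (s : R) : measurable_fun setT
  (fun t => expR (- (s * t)) * k ((t / lambda) `^ theta^-1)).
Proof.
apply: (measurable_funM (mexp s (@measurable_id _ _ _))).
have md : measurable_fun setT (fun t : R => t / lambda) by exact: measurable_funM.
exact: (measurableT_comp mk (measurableT_comp (measurable_powR theta^-1) md)).
Qed.

Lemma laplace_powR_subst (s : R) :
  laplace (fun t => k ((t / lambda) `^ theta^-1)) s =
  (\int[@lebesgue_measure R]_(x in `]0%R, +oo[)
    (expR (- (s * (lambda * x `^ theta))) * k x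
     * (lambda * (theta * x `^ (theta - 1))))%:E)%E.
Proof.
have mfE : measurable_fun setT
    (fun x => (expR (- (s * (lambda * x `^ theta))) * k x)%:E).
  by apply/measurable_EFinP; exact: mf.
rewrite -[RHS](ge0_integral_powR_subst l0 t0 mfE (f0 s)).
apply: eq_integral => t; rewrite inE/= in_itv/= andbT => tpos.
have lt : lambda * (t / lambda) = t by rewrite mulrCA divff ?mulr1// gt_eqF.
by rewrite (powRVK_pos t0 (ltW (divr_gt0 tpos l0))) lt.
Qed.

(** Nonnegativity of the integrand lets the constant enter the integral even if the transform is
    infinite; this matters because finiteness is only deduced afterwards. *)
Lemma ge0_laplace_powRZl (s c : R) : 0 <= c ->
  (c%:E * laplace (fun t => k ((t / lambda) `^ theta^-1)) s =
  \int[@lebesgue_measure R]_(x in `]0%R, +oo[)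
    (c * (expR (- (s * (lambda * x `^ theta))) * k x
     * (lambda * (theta * x `^ (theta - 1)))))%:E)%E.
Proof.
move=> c0; rewrite laplace_powR_subst.
have mw : measurable_fun setT (fun x => lambda * (theta * x `^ (theta - 1))).
  by do 2 apply: measurable_funM => //; exact: measurable_powR.
have mfw := measurable_funM (mf s) mw.
rewrite -ge0_integralZl_EFin.
- by [].
- exact: measurable_itv.
- by move=> x _; rewrite lee_fin mulr_ge0 ?mulr_ge0 ?expR_ge0 ?powR_ge0// ltW.
- by apply/measurable_EFinP; exact: measurable_funTS.
- by [].
Qed.

End laplace_powR.

(** * The density of [X] as an inverse Laplace transform *)

Unset Implicit Arguments.

Theorem theorem1 (d : measure_display) (T : measurableType d) (R : realType)
  (P : probability T R) (X Y Z : {RV P >-> R}) (fX fY fZ : R -> R)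
  (A B : R -> R) (lambda theta : R) :
  as_positive P X -> as_positive P Y -> as_positive P Z ->
  is_density P X fX -> is_density P Y fY -> is_density P Z fZ ->
  indep2 P X Y ->
  eq_in_dist P Z (fun w => X w / (X w + Y w)) ->
  0 < lambda -> 0 < theta ->
  (forall x, 0 < x -> 0 < A x) -> (forall x, 0 < x -> 0 < B x) ->
  (forall x s, 0 < x -> 0 < s ->
     fY (s * x) = A s * B x * expR (- (lambda * (s * x) `^ theta))) ->
  exists g : R -> R,
    is_inv_laplace
      (fun s => (A (s `^ theta^-1) * (s `^ theta^-1 + 1) ^+ 2)^-1
                * fZ ((s `^ theta^-1 + 1)^-1)) g /\
    forall x, 0 < x ->
      fX x = lambda * theta / (x `^ (2 - theta) * B x) * g (lambda * x `^ theta).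
Proof.
move=> X0 Y0 _ dX dY dZ XY ZXY l0 t0 A0 B0 fYE.
have [fX0 [mfX _]] := dX; have [fY0 [mfY _]] := dY.
have p0 : 0 < theta^-1 by rewrite invr_gt0.
(* B is not assumed measurable; on the positive reals it is recovered from fY
   by taking s = 1 in the decomposition. *)
pose Bm x := fY x / A 1 * expR (lambda * x `^ theta).
have BmE x : 0 < x -> Bm x = B x.
  move=> x0; rewrite /Bm -[in fY x](mul1r x) fYE// mul1r expRN.
  by field; rewrite ?gt_eqF ?expR_gt0 ?A0.
have mpowR (q : R) : measurable_fun setT (fun x : R => x `^ q).
  exact: measurable_powR.
have mBm : measurable_fun setT Bm.
  apply: measurable_funM; first exact: measurable_funM.
  by apply: (measurableT_comp (@measurable_expR R)); exact: measurable_funM.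
have Bm0 x : 0 <= Bm x by rewrite mulr_ge0 ?expR_ge0// divr_ge0// ltW ?A0.
(* The claimed formula is solved for the value of the inverse transform at lambda x^theta, with [Bm]
   for [B] to keep it measurable; [g] below is [k] composed with the inverse of x -> lambda
   x^theta. *)
pose k x := fX x * x `^ (2 - theta) * Bm x / (lambda * theta).
have k0 x : 0 <= k x.
  by apply: divr_ge0; rewrite mulr_ge0 ?(ltW l0) ?(ltW t0)// mulr_ge0 ?powR_ge0.
have mk : measurable_fun setT k.
  by apply: measurable_funM => //; do 2 apply: measurable_funM => //.
pose g t := k ((t / lambda) `^ theta^-1).
exists g; split; last first.
  move=> x x0; have xt : 0 < x `^ (2 - theta) by rewrite powR_gt0.
  have -> : g (lambda * x `^ theta) = k x.
    have lx : lambda * x `^ theta / lambda = x `^ theta.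
      by rewrite mulrAC divff ?mul1r// gt_eqF.
    by rewrite /g lx (powRK_pos t0 (ltW x0)).
  rewrite /k BmE//.
  by field; rewrite !gt_eqF ?B0.
(* The exponent is p = 1 / theta, so that s^p is [u] and [du] is its derivative at [s]. *)
have := ratio_density_ae X0 Y0 dX dY dZ XY ZXY p0.
apply: filterS => [|s hs s0].
  exact: (ae_filter_ringOfSetsType (@lebesgue_measure R)).
have {hs} := hs _; rewrite /= in_itv/= andbT => /(_ s0).
set u := s `^ theta^-1; set du := theta^-1 * s `^ (theta^-1 - 1) => qE.
have u0 : 0 < u by rewrite powR_gt0.
have du0 : 0 < du by rewrite mulr_gt0 ?powR_gt0.
pose e t := expR (- (s * t)) * g t.
have e0 t : 0 <= e t by rewrite mulr_ge0 ?expR_ge0 ?k0.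
have LE : laplace g s = ((A u * (u + 1) ^+ 2)^-1 * fZ (u + 1)^-1)%:E.
  set L := (X in X = _).
  (* Since u^theta = s, the decomposition of [fY] at u x produces the exponential of -s lambda
     x^theta, which is the Laplace kernel at t = lambda x^theta. *)
  have kerE : (\int[@lebesgue_measure R]_x
      (ratio_kernel fX fY theta^-1 x s)%:E)%E = ((A u * du)%:E * L)%E.
    have Au0 : 0 <= A u * du by rewrite mulr_ge0 ?(ltW du0)// ltW// A0.
    rewrite /L (ge0_laplace_powRZl l0 t0 mk k0 s Au0).
    rewrite [RHS]integral_mkcond; apply: eq_integral => x _.
    rewrite patchE /ratio_kernel indicE; case: ifPn => [|_]; last by rewrite !mul0r.
    rewrite inE/= in_itv/= andbT => x0.
    have spos : s \in (`]0%R, +oo[%classic : set R) by rewrite inE/= in_itv/= s0.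
    rewrite indicE spos !mul1r; congr EFin.
    rewrite -/u -/du [x * u]mulrC fYE// /k BmE// powRM ?ltW// powRVK_pos ?ltW//.
    (* The power in [k] and the one from dt = lambda theta x^(theta - 1) dx combine into the factor
       x of the ratio kernel. *)
    have xE : x `^ (2 - theta) * x `^ (theta - 1) = x.
      rewrite -powRD; last by rewrite (gt_eqF x0) implybT.
      by rewrite addrA subrK -[1]/(1%:R) -natrB// powRr1// ltW.
    have -> : x * du = x `^ (2 - theta) * x `^ (theta - 1) * du by rewrite xE.
    rewrite [lambda * (s * _)]mulrCA.
    by field; rewrite !gt_eqF.
  move: qE; rewrite kerE => qE.
  have Au0 : 0 < A u * du by rewrite mulr_gt0 ?A0.
  (* [L] is an extended real not yet known to be finite, so the cancellation is made by multiplying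
     with the inverse of a positive real. *)
  have -> : L = (((A u * du)^-1)%:E * ((A u * du)%:E * L))%E.
    by rewrite muleA -EFinM mulVf ?mul1e// gt_eqF.
  rewrite -qE -EFinM; congr EFin.
  have Au : 0 < A u by rewrite A0.
  have u1 : 0 < u + 1 by rewrite addr_gt0.
  by field; rewrite !gt_eqF.
split; last exact: LE.
(* The integrand is nonnegative, so the integral of its absolute value is the transform itself,
   finite by [LE]. *)
apply/integrableP; split.
  by apply/measurable_EFinP; apply: measurable_funTS;
    exact: measurable_laplace_powR_integrand.
rewrite (_ : integral _ _ _ = laplace g s); last first.
  rewrite /laplace; apply: eq_integral => t _; rewrite gee0_abs; first by [].
  by rewrite lee_fin; exact: e0.
by rewrite LE ltry.
Qed.
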